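(* Let $(V_i)_{i\in I}$ be a family of complex inner product spaces. Then the R$^*$-algebra $\bigoplus_{i\in I}F(V_i)$ is purely atomic. Conversely, every purely atomic R$^*$-algebra is $^*$-isomorphic to $\bigoplus_{i\in I}F(V_i)$ for some family $(V_i)_{i\in I}$ of complex inner product spaces.
   Context: An R$^*$-algebra is a (not necessarily closed, not necessarily unital) $^*$-subalgebra $A$ of $B(H)$, $H$ a complex Hilbert space, such that every self-adjoint element of $A$ has finite spectrum. An atom of $A$ is a minimal nonzero projection in $A$; $A$ is purely atomic if every projection of $A$ is a sum of finitely many atoms of $A$. For an inner product space $V$ with completion $H$, $F(V)$ is the set of finite-rank operators $x\in B(H)$ whose range and the range of $x^*$ are contained in $V$. For R$^*$-algebras $A_i\subset B(H_i)$, $\bigoplus_{i\in I}A_i$ denotes the $^*$-subalgebra of $B(\bigoplus_i H_i)$ consisting of finitely supported families $(x_i)_{i}$ with $x_i\in A_i$, acting diagonally. A $^*$-isomorphism is a linear multiplicative $^*$-preserving bijection. *)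

(* Defs.v *)
From Stdlib Require Lists.List.
From mathcomp Require Import all_boot all_order all_algebra.
From mathcomp Require Import reals complex.
Set Implicit Arguments. Unset Strict Implicit. Unset Printing Implicit Defensive.
Import Order.TTheory GRing.Theory Num.Theory.
Local Open Scope ring_scope.
Local Open Scope complex_scope.

Section Defs.
Variable R : realType.
Local Notation C := (complex R).

(** Complex Hilbert spaces: complex vector space with an inner product
    (linear in the first argument, conjugate-symmetric, positive definite)
    that is complete for the induced norm.  Distances are measured through
    the squared norm  <x-y, x-y>  (a nonnegative real element of C). *)
Definition cauchy_seq (E : lmodType C) (ip : E -> E -> C) (u : nat -> E) :=
  forall eps : C, 0 < eps ->
    exists N : nat, forall m n, (N <= m)%N -> (N <= n)%N ->
      ip (u m - u n) (u m - u n) < eps.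

Definition converges_to (E : lmodType C) (ip : E -> E -> C) (u : nat -> E) (l : E) :=
  forall eps : C, 0 < eps ->
    exists N : nat, forall n, (N <= n)%N -> ip (u n - l) (u n - l) < eps.

Record hilbert := Hilbert {
  hcar :> lmodType C;
  hinner : hcar -> hcar -> C;
  hinner_linl : forall (a : C) (x1 x2 y : hcar),
      hinner (a *: x1 + x2) y = a * hinner x1 y + hinner x2 y;
  hinner_conj : forall x y : hcar, hinner y x = (hinner x y)^*;
  hinner_ge0 : forall x : hcar, 0 <= hinner x x;
  hinner_def : forall x : hcar, hinner x x = 0 -> x = 0;
  hcomplete : forall u : nat -> hcar,
      cauchy_seq hinner u -> exists l, converges_to hinner u l
}.

Definition lin_op (H : hilbert) (x : H -> H) :=
  forall (a : C) (u v : H), x (a *: u + v) = a *: x u + x v.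

Definition bounded_op (H : hilbert) (x : H -> H) :=
  lin_op x /\ exists M : C, 0 <= M /\
    forall u : H, hinner (x u) (x u) <= M * hinner u u.

Definition is_adj (H : hilbert) (x y : H -> H) :=
  forall u v : H, hinner (x u) v = hinner u (y v).

(** Abstract signature of a complex *-algebra (adjoint given as a relation
    "y = x^*"). *)
Record staralg (T : Type) := StarAlg {
  sa_zero : T;
  sa_add : T -> T -> T;
  sa_scale : C -> T -> T;
  sa_mul : T -> T -> T;
  sa_adj : T -> T -> Prop
}.

Definition Bops (H : hilbert) : staralg (H -> H) :=
  @StarAlg (H -> H) (fun _ => 0) (fun x y u => x u + y u)
    (fun a x u => a *: x u) (fun x y => x \o y) (@is_adj H).

Definition star_subalg (H : hilbert) (A : (H -> H) -> Prop) :=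
  (forall x, A x -> bounded_op x) /\
  A (fun _ => 0) /\
  (forall x y, A x -> A y -> A (fun u => x u + y u)) /\
  (forall (a : C) x, A x -> A (fun u => a *: x u)) /\
  (forall x y, A x -> A y -> A (x \o y)) /\
  (forall x, A x -> exists2 y, A y & is_adj x y).

Definition spectrum (H : hilbert) (x : H -> H) (l : C) :=
  ~ exists y : H -> H, [/\ bounded_op y,
       forall u, y (x u - l *: u) = u
     & forall u, x (y u) - l *: y u = u].

Definition finite_spectrum (H : hilbert) (x : H -> H) :=
  exists s : seq C, forall l, spectrum x l -> l \in s.

Definition Rstar_alg (H : hilbert) (A : (H -> H) -> Prop) :=
  star_subalg A /\ forall x, A x -> is_adj x x -> finite_spectrum x.

Section Atoms.
Variables (T : Type) (ops : staralg T) (A : T -> Prop).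

Definition is_proj (p : T) :=
  [/\ A p, sa_adj ops p p & sa_mul ops p p = p].

(** minimal nonzero projection (q <= p means q p = q) *)
Definition is_atom (p : T) :=
  [/\ is_proj p, p <> sa_zero ops &
      forall q, is_proj q -> sa_mul ops q p = q ->
        q <> sa_zero ops -> q = p].

Definition purely_atomic :=
  forall p, is_proj p -> exists s : seq T,
    (forall q, Stdlib.Lists.List.In q s -> is_atom q) /\
    p = foldr (sa_add ops) (sa_zero ops) s.
End Atoms.

Definition star_iso (T U : Type) (ops : staralg T) (A : T -> Prop)
    (ops' : staralg U) (B : U -> Prop) (f : T -> U) :=
  (forall x, A x -> B (f x)) /\
  (forall x y, A x -> A y -> f x = f y -> x = y) /\
  (forall z, B z -> exists2 x, A x & f x = z) /\
  (forall x y, A x -> A y -> f (sa_add ops x y) = sa_add ops' (f x) (f y)) /\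
  (forall (a : C) x, A x -> f (sa_scale ops a x) = sa_scale ops' a (f x)) /\
  (forall x y, A x -> A y -> f (sa_mul ops x y) = sa_mul ops' (f x) (f y)) /\
  (forall x y, A x -> A y -> sa_adj ops x y -> sa_adj ops' (f x) (f y)).

(** A complex inner product space V, given together with its completion H:
    V is a dense linear subspace of the Hilbert space H. *)
Definition dense_subspace (H : hilbert) (V : H -> Prop) :=
  [/\ V 0,
      forall (a : C) (u v : H), V u -> V v -> V (a *: u + v)
    & forall (u : H) (eps : C), 0 < eps ->
        exists2 v, V v & hinner (u - v) (u - v) < eps].

Definition finrank_op (H : hilbert) (V : H -> Prop) (x : H -> H) :=
  [/\ bounded_op x,
      exists s : seq H, forall u, exists c : nat -> C,
         x u = \sum_(i < size s) c i *: s`_i,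
      forall u, V (x u)
    & exists2 y, is_adj x y & forall u, V (y u)].

Definition DSops (I : Type) (K : I -> hilbert) :
    staralg (forall i, K i -> K i) :=
  @StarAlg (forall i, K i -> K i) (fun i _ => 0)
    (fun x y i u => x i u + y i u) (fun a x i u => a *: x i u)
    (fun x y i u => x i (y i u))
    (fun x y => forall i, is_adj (x i) (y i)).

Definition dsum_F (I : Type) (K : I -> hilbert) (V : forall i, K i -> Prop)
    (x : forall i, K i -> K i) :=
  (forall i, finrank_op (V i) (x i)) /\
  exists J : seq I, forall i, ~ Stdlib.Lists.List.In i J -> x i = (fun _ => 0).

End Defs.

(* Main.v *)
Require Import Defs.
From HB Require Import structures.
From mathcomp Require Import all_boot all_order all_algebra.
From mathcomp Require Import boolp classical_sets reals complex lra ring.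
Set Implicit Arguments. Unset Strict Implicit. Unset Printing Implicit Defensive.
Import Order.TTheory GRing.Theory Num.Theory.

(** For the direct sum, a finite-rank projection with range in [V] is the sum of
    the rank-one projections on the vectors of an orthonormal basis of its
    range, and rank-one projections are atoms.

    Conversely, let [A] be a purely atomic R*-algebra.  A self-adjoint [x] in [A]
    is annihilated by a polynomial with roots in its spectrum, so [A] contains a
    projection [e = x k] with [x e = x].  It follows that [p A p] consists of the
    multiples of [p] for each atom [p], and, applying this to [x^* x], that every
    [x] in [A] is a finite sum of products [x p] with [p] an atom.  Call two
    atoms [p] and [q] linked when [p A q <> 0].  Choose an atom [p_i] in each
    class of linked atoms and a unit vector [xi_i] in its range; then [A] leaves
    [V_i = A xi_i] and its closure [K_i] in [H] invariant, and [p_i] acts on [K_i]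
    as the projection on the line of [xi_i], while atoms not linked to [p_i] vanish
    there.  The isomorphism is the restriction of [x] to the family [K_i]; the
    rank-one operator of [F(V_i)] given by [a xi_i] and [b xi_i] is the
    restriction of [a p_i b^*]. *)

(** * Inner products, squared norms and bounded operators *)

Section InnerProduct.
Local Open Scope ring_scope.
Local Open Scope complex_scope.
Variables (R : realType) (H : hilbert R).
Implicit Types (u v w e : H) (x y : H -> H) (a : R[i]).

Lemma ipDl u v w : hinner (u + v) w = hinner u w + hinner v w.
Proof. by rewrite -{1}(scale1r u) hinner_linl mul1r. Qed.

Lemma ip0l w : hinner (0 : H) w = 0.
Proof. by apply: (addrI (hinner (0 : H) w)); rewrite -ipDl !addr0. Qed.

Lemma ipZl a u w : hinner (a *: u) w = a * hinner u w.
Proof. by rewrite -[a *: u]addr0 hinner_linl ip0l addr0. Qed.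

Lemma ipNl u w : hinner (- u) w = - hinner u w.
Proof. by rewrite -scaleN1r ipZl mulN1r. Qed.

Lemma ipBl u v w : hinner (u - v) w = hinner u w - hinner v w.
Proof. by rewrite ipDl ipNl. Qed.

Lemma ipDr u v w : hinner w (u + v) = hinner w u + hinner w v.
Proof. by rewrite hinner_conj ipDl rmorphD /= -!hinner_conj. Qed.

Lemma ip0r w : hinner w (0 : H) = 0.
Proof. by rewrite hinner_conj ip0l rmorph0. Qed.

Lemma ipZr a u w : hinner w (a *: u) = conjc a * hinner w u.
Proof. by rewrite hinner_conj ipZl rmorphM /= -hinner_conj. Qed.

Lemma ipNr u w : hinner w (- u) = - hinner w u.
Proof. by rewrite hinner_conj ipNl rmorphN /= -hinner_conj. Qed.

Lemma ipBr u v w : hinner w (u - v) = hinner w u - hinner w v.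
Proof. by rewrite ipDr ipNr. Qed.

Lemma ip_suml (T : Type) (s : seq T) (F : T -> H) w :
  hinner (\sum_(t <- s) F t) w = \sum_(t <- s) hinner (F t) w.
Proof.
by elim: s => [|t s IH]; rewrite ?big_nil ?ip0l // !big_cons ipDl IH.
Qed.

Lemma ip_ext u v : (forall w, hinner u w = hinner v w) -> u = v.
Proof.
move=> E; apply/eqP; rewrite -subr_eq0; apply/eqP/hinner_def.
by rewrite ipBl E subrr.
Qed.

Lemma ip_extr u v : (forall w, hinner w u = hinner w v) -> u = v.
Proof. by move=> E; apply: ip_ext => w; rewrite hinner_conj E -hinner_conj. Qed.

(** The squared norm moved to the totally ordered field [R], where linear arithmetic and infima
    apply. *)
Definition nsq u : R := complex.Re (hinner u u).

Lemma nsqE u : hinner u u = (nsq u)%:C.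
Proof. by rewrite /nsq RRe_real // ger0_real // hinner_ge0. Qed.

Lemma nsq_ge0 u : 0 <= nsq u.
Proof. by rewrite -ler0c -nsqE hinner_ge0. Qed.

Lemma nsq_eq0 u : (nsq u == 0) = (u == 0).
Proof.
apply/eqP/eqP => [E|->]; last by rewrite /nsq ip0l.
by apply: hinner_def; rewrite nsqE E.
Qed.

Lemma nsq0 : nsq 0 = 0. Proof. by rewrite /nsq ip0l. Qed.

Lemma nsqN u : nsq (- u) = nsq u.
Proof. by rewrite /nsq ipNl ipNr opprK. Qed.

Lemma nsqD_le u v : nsq (u + v) <= 2 * nsq u + 2 * nsq v.
Proof.
(* Parallelogram law. *)
have -> : 2 * nsq u + 2 * nsq v = nsq (u + v) + nsq (u - v).
  apply: complexI; rewrite !rmorphD /= !rmorphM /= -!nsqE.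
  rewrite !(ipBl, ipDl, ipBr, ipDr) rmorph_nat; ring.
by rewrite lerDl nsq_ge0.
Qed.

Lemma nsqZ a u : nsq (a *: u) = complex.Re (a * conjc a) * nsq u.
Proof.
apply: complexI; rewrite -nsqE ipZl ipZr nsqE mulrA rmorphM /=; congr (_ * _).
by rewrite RRe_real // ger0_real // mulcJ_ge0.
Qed.

Lemma bounded_nsqP x : bounded_op x <->
  lin_op x /\ exists2 m : R, 0 <= m & forall u, nsq (x u) <= m * nsq u.
Proof.
split=> -[xl [m]]; last first.
  move=> m0 xm; split=> //; exists m%:C; split; first by rewrite ler0c.
  by move=> u; rewrite !nsqE -rmorphM lecR.
move=> [m0 xm]; have mE : (complex.Re m)%:C = m by rewrite RRe_real // ger0_real.
split=> //; exists (complex.Re m) => [|u]; first by rewrite -ler0c mE.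
by rewrite -lecR rmorphM /= mE -!nsqE; exact: xm.
Qed.

Section Linear.
Variable x : H -> H.
Hypothesis xl : lin_op x.

Lemma linD u v : x (u + v) = x u + x v.
Proof. by rewrite -[u]scale1r xl !scale1r. Qed.

Lemma lin0 : x 0 = 0.
Proof. by apply: (addrI (x 0)); rewrite -linD !addr0. Qed.

Lemma linZ a u : x (a *: u) = a *: x u.
Proof. by rewrite -[a *: u]addr0 xl lin0 addr0. Qed.

Lemma linN u : x (- u) = - x u.
Proof. by rewrite -scaleN1r linZ scaleN1r. Qed.

Lemma linB u v : x (u - v) = x u - x v.
Proof. by rewrite linD linN. Qed.

Lemma lin_sum (T : Type) (s : seq T) (F : T -> H) :
  x (\sum_(t <- s) F t) = \sum_(t <- s) x (F t).
Proof.
by elim: s => [|t s IH]; rewrite ?big_nil ?lin0 // !big_cons linD IH.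
Qed.
End Linear.

Lemma is_adj_sym x y : is_adj x y -> is_adj y x.
Proof. by move=> xy u v; rewrite hinner_conj -xy -hinner_conj. Qed.

Lemma unit_scale w : w != 0 -> exists2 a, a != 0 & hinner (a *: w) (a *: w) = 1.
Proof.
move=> w0; have n0 : 0 < nsq w by rewrite lt_def nsq_eq0 w0 nsq_ge0.
exists ((Num.sqrt (nsq w))^-1)%:C.
  by rewrite (fmorph_eq0 (real_complex R)) invr_eq0 sqrtr_eq0 -ltNge.
rewrite ipZl ipZr conjc_real nsqE -!rmorphM -[RHS](rmorph1 (real_complex R)) /=.
congr (_%:C); rewrite mulrA -invfM -expr2 sqr_sqrtr ?nsq_ge0 //.
by rewrite mulVf // gt_eqF.
Qed.

Lemma bounded_add x y : bounded_op x -> bounded_op y ->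
  bounded_op (fun u => x u + y u).
Proof.
move=> /bounded_nsqP[xl [m m0 xm]] /bounded_nsqP[yl [n n0 yn]].
apply/bounded_nsqP; split.
  by move=> a u v; rewrite xl yl scalerDr addrACA.
exists (2 * m + 2 * n); first by rewrite addr_ge0 ?mulr_ge0.
move=> u; apply: (le_trans (nsqD_le _ _)).
by have := xm u; have := yn u; lra.
Qed.

Lemma bounded_scale a x : bounded_op x -> bounded_op (fun u => a *: x u).
Proof.
move=> /bounded_nsqP[xl [m m0 xm]]; apply/bounded_nsqP; split.
  by move=> b u v; rewrite xl scalerDr !scalerA [a * b]mulrC.
have a0 : 0 <= complex.Re (a * conjc a).
  by rewrite -ler0c RRe_real ?ger0_real // mulcJ_ge0.
exists (complex.Re (a * conjc a) * m) => [|u]; first by rewrite mulr_ge0.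
by rewrite nsqZ -mulrA ler_wpM2l.
Qed.

Lemma bounded_comp x y : bounded_op x -> bounded_op y -> bounded_op (x \o y).
Proof.
move=> /bounded_nsqP[xl [m m0 xm]] /bounded_nsqP[yl [n n0 yn]].
apply/bounded_nsqP; split.
  by move=> a u v; rewrite /= yl xl.
exists (m * n) => [|u]; first by rewrite mulr_ge0.
by apply: (le_trans (xm _)); rewrite -mulrA ler_wpM2l.
Qed.

Lemma bounded_proj1 e : hinner e e = 1 ->
  bounded_op (fun u => hinner u e *: e).
Proof.
move=> e1; apply/bounded_nsqP; split.
  by move=> a u v; rewrite hinner_linl scalerDl scalerA.
exists 1 => // u; rewrite mul1r.
(* Pythagoras, for the component of [u] along [e] and the remainder. *)
suff -> : nsq (hinner u e *: e) = nsq u - nsq (u - hinner u e *: e).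
  by rewrite gerBl nsq_ge0.
apply: complexI; rewrite rmorphB /= -!nsqE.
rewrite !(ipBl, ipBr, ipZl, ipZr) e1 (hinner_conj u e).
by ring.
Qed.

End InnerProduct.

(** * Polynomials in an operator with finite spectrum *)

Section FiniteSpectrum.
Local Open Scope ring_scope.
Local Open Scope complex_scope.
Variables (R : realType) (H : hilbert R) (x : H -> H).
Implicit Types (u v : H) (p : {poly R[i]}) (s : seq R[i]).

Definition poly_op p u : H := \sum_(i < size p) p`_i *: iter i x u.

Lemma poly_op_wide n p u : (size p <= n)%N ->
  poly_op p u = \sum_(i < n) p`_i *: iter i x u.
Proof.
move=> pn; rewrite /poly_op (big_ord_widen n (fun i => p`_i *: iter i x u) pn).
rewrite big_mkcond; apply: eq_bigr => i _; case: ltnP => // ip.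
by rewrite nth_default // scale0r.
Qed.

Lemma poly_opD p q u : poly_op (p + q) u = poly_op p u + poly_op q u.
Proof.
pose n := maxn (size p) (size q).
rewrite (@poly_op_wide n) ?size_polyD // (@poly_op_wide n p) ?leq_maxl //.
rewrite (@poly_op_wide n q) ?leq_maxr // -big_split /=.
by apply: eq_bigr => i _; rewrite coefD scalerDl.
Qed.

Lemma poly_opZ a p u : poly_op (a *: p) u = a *: poly_op p u.
Proof.
rewrite (@poly_op_wide (size p)) ?size_scale_leq // /poly_op scaler_sumr.
by apply: eq_bigr => i _; rewrite coefZ scalerA.
Qed.

Lemma poly_opC a u : poly_op a%:P u = a *: u.
Proof. by rewrite (@poly_op_wide 1) ?size_polyC_leq1 // big_ord1 coefC. Qed.

(** Kept in factored form, so that factors can be inverted or removed one at a time by induction on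
    the list. *)
Definition root_prod s u : H := foldr (fun a v => x v - a *: v) u s.

Hypothesis xl : lin_op x.

Lemma poly_opMX p u : poly_op (p * 'X) u = x (poly_op p u).
Proof.
have szX : (size (p * 'X)%R <= (size p).+1)%N.
  by apply: leq_trans (size_polyMleq _ _) _; rewrite size_polyX addn2.
rewrite (poly_op_wide _ szX) big_ord_recl coefMX /= scale0r add0r /poly_op (lin_sum xl).
by apply: eq_bigr => i _; rewrite coefMX /= (linZ xl).
Qed.

Lemma poly_op_prod s u : poly_op (\prod_(a <- s) ('X - a%:P)) u = root_prod s u.
Proof.
elim: s => [|a s IH] /=; first by rewrite big_nil -[1]/(1%:P) poly_opC scale1r.
rewrite big_cons mulrC mulrBr poly_opD poly_opMX IH mulrC mul_polyC.
by rewrite -[- (a *: \prod_(_ <- _) _)]scaleNr poly_opZ IH scaleNr.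
Qed.

Lemma root_prod_lin s : lin_op (root_prod s).
Proof.
move=> b u v; elim: s => [//|a s /= ->].
by rewrite xl scalerBr [a *: (_ + _)]scalerDr opprD !scalerA [a * b]mulrC addrACA.
Qed.

Lemma root_prod_self s u : root_prod s (x u) = x (root_prod s u).
Proof. by elim: s => [//|a s /= ->]; rewrite (linB xl) (linZ xl). Qed.

Lemma root_prod_comm s t u : root_prod s (root_prod t u) = root_prod t (root_prod s u).
Proof.
elim: t => [//|a t /= <-].
by rewrite (linB (root_prod_lin s)) root_prod_self (linZ (root_prod_lin s)).
Qed.

Lemma root_prod_cat s t u : root_prod (s ++ t) u = root_prod s (root_prod t u).
Proof. by rewrite /root_prod foldr_cat. Qed.

Lemma root_prod_bounded s : bounded_op x -> bounded_op (root_prod s).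
Proof.
move=> xb; elim: s => [|a s IH] /=.
  by apply/bounded_nsqP; split=> [//|]; exists 1 => // u; rewrite mul1r.
have := bounded_add (bounded_comp xb IH) (bounded_scale (- a) IH).
by congr bounded_op; apply: funext => u; rewrite /= scaleNr.
Qed.

Lemma root_prod_adj s u v : is_adj x x ->
  hinner (root_prod s u) v = hinner u (root_prod (map conjc s) v).
Proof.
move=> xx; elim: s u v => [//|a s IH] u v /=.
rewrite ipBl ipZl xx -[a in LHS]conjcK -ipZr -ipBr IH.
by rewrite (linB (root_prod_lin _)) root_prod_self (linZ (root_prod_lin _)).
Qed.

(** Each factor [x - a] has a bounded inverse, hence is bounded below, and lower bounds multiply
    along the product. *)
Lemma root_prod_lower_bound s : (forall a, a \in s -> ~ spectrum x a) ->
  exists2 M : R, 0 <= M & forall u, nsq u <= M * nsq (root_prod s u).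
Proof.
elim: s => [|a s IH] sN; first by exists 1 => // u; rewrite mul1r.
have [b bs|M M0 sM] := IH; first by apply: sN; rewrite inE bs orbT.
have /contrapT[y [/bounded_nsqP[_ [m m0 ym]] yK _]] := sN a (mem_head _ _).
exists (M * m) => [|u]; first by rewrite mulr_ge0.
apply: (le_trans (sM u)); rewrite -mulrA ler_wpM2l //.
by rewrite -{1}(yK (root_prod s u)).
Qed.

(* With [y] the product over a list [s] containing the spectrum and [mu] the
   square of the norm of [y], the operator [y^* y - mu] is not bounded below,
   so one of its linear factors [x - alpha] is not invertible; as [alpha] is
   in the spectrum, it is a root of the polynomial of [y], whence [mu = 0]. *)
Lemma finite_spectrum_annihil :
    bounded_op x -> is_adj x x -> finite_spectrum x ->
  exists s, forall u, root_prod s u = 0.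
Proof.
move=> xb xx [s0 s0P].
(* Adding [0] makes the list nonempty, so that [r] below is not constant. *)
have [s sP sN0] : exists2 s, forall a, spectrum x a -> a \in s & (0 < size s)%N.
  by exists (0 :: s0) => // a /s0P a0; rewrite inE a0 orbT.
pose sb := map conjc s.
have conjsb : map conjc sb = s by rewrite /sb mapK //; exact: conjcK.
have Tin u : hinner (root_prod s u) (root_prod s u) =
    hinner u (root_prod sb (root_prod s u)).
  exact: root_prod_adj.
(* The operator y = [root_prod s] commutes with its adjoint [root_prod sb], so it is normal. *)
have sbE u : nsq (root_prod sb u) = nsq (root_prod s u).
  by rewrite /nsq root_prod_adj // conjsb root_prod_comm -Tin.
pose S := [set m : R | 0 <= m /\ forall u, nsq (root_prod s u) <= m * nsq u]%classic.
have S0 : nonempty S.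
  by have /bounded_nsqP[_ [m m0 mP]] := root_prod_bounded s xb; exists m.
have Slb : lbound S 0 by move=> m [].
have mu0 : 0 <= inf S by apply: lb_le_inf.
have muP u : nsq (root_prod s u) <= inf S * nsq u.
  have [u0|n0] := eqVneq u 0.
    by rewrite u0 (lin0 (root_prod_lin s)) nsq0 mulr0.
  have {}n0 : 0 < nsq u by rewrite lt_def nsq_eq0 n0 nsq_ge0.
  rewrite -ler_pdivrMr //; apply: lb_le_inf => // m [_ mP].
  by rewrite ler_pdivrMr.
set mu := inf S in mu0 muP.
have [mu_eq0|mu_neq0] := eqVneq mu 0.
  exists s => u; apply/eqP; rewrite -nsq_eq0 eq_le nsq_ge0 andbT.
  by have := muP u; rewrite mu_eq0 mul0r.
exfalso; have mu_gt0 : 0 < mu by rewrite lt_def mu_neq0.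
(* [r] is the polynomial of y^* y, and [p] that of y^* y - mu. *)
pose r : {poly R[i]} := \prod_(a <- sb ++ s) ('X - a%:P).
pose p := r - (mu%:C)%:P.
have pN0 : p != 0.
  rewrite subr_eq0; apply/eqP => /(congr1 (fun q : {poly _} => size q)).
  rewrite size_prod_XsubC size_cat size_polyC.
  move=> E; move: sN0; have := leq_b1 (mu%:C != 0); rewrite -E.
  by case: (size s) => // n; rewrite addnS.
have [rs pE] := closed_field_poly_normal p.
have rsP a : a \in rs -> ~ spectrum x a.
  move=> ars spa; have : root p a.
    by rewrite pE rootZ ?lead_coef_eq0 // root_prod_XsubC.
  have : root r a.
    by rewrite root_prod_XsubC mem_cat (sP _ spa) orbT.
  rewrite /root hornerD hornerN hornerC => /eqP ->.
  by rewrite sub0r oppr_eq0 (fmorph_eq0 (real_complex R)) (negPf mu_neq0).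
have [M M0 MP] := root_prod_lower_bound rsP.
have p_opE u : poly_op p u = root_prod sb (root_prod s u) - mu%:C *: u.
  by rewrite poly_opD poly_op_prod root_prod_cat -polyCN poly_opC scaleNr.
have p_opE' u : poly_op p u = lead_coef p *: root_prod rs u.
  by rewrite pE poly_opZ poly_op_prod -pE.
have [M' M'0 M'P] : exists2 M' : R, 0 <= M' &
    forall u, nsq u <= M' * nsq (root_prod sb (root_prod s u) - mu%:C *: u).
  pose c := complex.Re (lead_coef p * conjc (lead_coef p)).
  have c0 : 0 < c.
    have := mulcJ_ge0 (lead_coef p); rewrite le_eqVlt eq_sym mulf_eq0.
    by rewrite conjc_eq0 orbb lead_coef_eq0 (negPf pN0) ltcE => /andP[].
  exists (M / c) => [|u]; first by rewrite divr_ge0 // ltW.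
  rewrite -p_opE p_opE' nsqZ -/c mulrA divfK ?gt_eqF //.
(* Expand the square; by normality y^* y u has the norm of y y u, which [muP] at y u bounds. *)
have nB u : nsq (root_prod sb (root_prod s u) - mu%:C *: u) <=
    mu * (mu * nsq u - nsq (root_prod s u)).
  have -> : nsq (root_prod sb (root_prod s u) - mu%:C *: u) =
    nsq (root_prod s (root_prod s u)) - 2 * mu * nsq (root_prod s u) + mu ^+ 2 * nsq u.
    have uT : hinner u (root_prod sb (root_prod s u)) = (nsq (root_prod s u))%:C.
      by rewrite -Tin nsqE.
    have Tu : hinner (root_prod sb (root_prod s u)) u = (nsq (root_prod s u))%:C.
      by rewrite hinner_conj uT conjc_real.
    rewrite -sbE; apply: complexI; rewrite -nsqE !(ipBl, ipBr, ipZl, ipZr).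
    rewrite conjc_real uT Tu !nsqE rmorphD /= rmorphB /= !rmorphM /= rmorph_nat.
    by ring.
  by have := muP (root_prod s u); lra.
(* The lower bound gives nsq u <= D (mu nsq u - nsq (y u)), which puts the larger of [0] and mu -
   1/D in [S], below its infimum. The summand 1 keeps [D] positive even if M' = 0. *)
pose D := M' * mu + 1.
have D0 : 0 < D by rewrite ltr_wpDl // mulr_ge0 // ltW.
pose m' := Num.max 0 (mu - D^-1).
have m'S : S m'.
  split=> [|u]; first by rewrite le_max lexx.
  apply: (@le_trans _ _ ((mu - D^-1) * nsq u)); last first.
    by rewrite ler_wpM2r ?nsq_ge0 // le_max lexx orbT.
  rewrite mulrBl lerBrDr -lerBrDl mulrC ler_pdivrMr // mulrC.
  apply: (le_trans (M'P u)); have := nB u; have := muP u.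
  move=> q0 q1; have := ler_wpM2l M'0 q1; rewrite /D; lra.
have : mu <= m' by apply: ge_inf => //; exists 0.
by rewrite leNgt gt_max mu_gt0 ltrBlDr ltrDl invr_gt0 D0.
Qed.

End FiniteSpectrum.

(** * Finite spans and orthonormal expansions *)

Section FiniteRank.
Local Open Scope ring_scope.
Local Open Scope complex_scope.
Variables (R : realType) (H : hilbert R).
Implicit Types (u v w e : H) (s : seq H) (a : R[i]).

(** Recursive form of the span, suited to adding one vector at a time; [lspanP] links it to the sums
    in [finrank_op]. *)
Fixpoint lspan s u : Prop :=
  if s is v :: s' then exists a, lspan s' (u - a *: v) else u = 0.

Lemma lspan_lin s a u v : lspan s u -> lspan s v -> lspan s (a *: u + v).
Proof.
elim: s u v => [|w s IH] u v /=; first by move=> -> ->; rewrite scaler0 addr0.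
move=> [b bu] [c cv]; exists (a * b + c).
suff -> : a *: u + v - (a * b + c) *: w = a *: (u - b *: w) + (v - c *: w).
  exact: IH.
by rewrite scalerBr scalerA scalerDl opprD addrACA.
Qed.

Lemma lspan0 s : lspan s 0.
Proof. by elim: s => [//|v s IH] /=; exists 0; rewrite scale0r subr0. Qed.

Lemma lspanP s u :
  lspan s u <-> exists c : nat -> R[i], u = \sum_(i < size s) c i *: s`_i.
Proof.
elim: s u => [|v s IH] u /=.
  split=> [->|[c]]; last by rewrite big_ord0.
  by exists (fun=> 0); rewrite big_ord0.
split=> [[a /IH[c uE]]|[c uE]].
  exists (fun i => if i is j.+1 then c j else a).
  by rewrite big_ord_recl /= -uE addrC subrK.
exists (c 0%N); apply/IH; exists (c \o S).
by rewrite uE big_ord_recl /= addrC addKr.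
Qed.

Lemma subspace_scale (W : H -> Prop) a u :
    W 0 -> (forall b v w, W v -> W w -> W (b *: v + w)) ->
  W u -> W (a *: u).
Proof. by move=> W0 Wl Wu; rewrite -[a *: u]addr0; apply: Wl. Qed.

Lemma subspace_sum (W : H -> Prop) s (c : H -> R[i]) :
    W 0 -> (forall b v w, W v -> W w -> W (b *: v + w)) ->
  (forall e, e \in s -> W e) -> W (\sum_(e <- s) c e *: e).
Proof.
move=> W0 Wl; elim: s => [|e s IH] sW; first by rewrite big_nil.
rewrite big_cons; apply: Wl; first exact/sW/mem_head.
by apply: IH => f fs; apply: sW; rewrite inE fs orbT.
Qed.

(* The list is not required to be orthogonal: the expansion property alone
   makes [w - \sum_(e <- es) hinner w e *: e] orthogonal to [W], which is what
   extends the list by one vector. *)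
Lemma parseval_basis s (W : H -> Prop) :
    W 0 -> (forall a u v, W u -> W v -> W (a *: u + v)) ->
    (forall u, W u -> lspan s u) ->
  exists2 es : seq H, forall e, e \in es -> W e /\ hinner e e = 1
    & forall w, W w -> w = \sum_(e <- es) hinner w e *: e.
Proof.
elim: s W => [|v s IH] W W0 Wl Wspan.
  by exists [::] => // w /Wspan /= ->; rewrite big_nil.
pose W' w := W w /\ lspan s w.
have [||w []//|es esW' esP] := IH W'.
- by split=> //; exact: lspan0.
- by move=> a u w [Wu su] [Ww sw]; split; [exact: Wl|exact: lspan_lin].
have W'0 : W' 0 by split=> //; exact: lspan0.
have W'l a u w : W' u -> W' w -> W' (a *: u + w).
  by move=> [Wu su] [Ww sw]; split; [exact: Wl|exact: lspan_lin].
have [sub|] := pselect (forall w, W w -> lspan s w).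
  exists es => [e /esW'[[]]//|w Ww]; apply: esP; split=> //; exact: sub.
move=> /existsNP[w0 /not_implyP[Ww0 Nw0]].
have [c cw0] := Wspan _ Ww0.
have c0 : c != 0 by apply/eqP => c0; apply: Nw0; rewrite c0 scale0r subr0 in cw0.
pose P w := \sum_(e <- es) hinner w e *: e.
have W'P w : W' (P w) by apply: subspace_sum => // e /esW'[].
pose d := w0 - P w0.
have d0 : d != 0.
  by apply/eqP => /eqP; rewrite subr_eq0 => /eqP E; apply: Nw0; rewrite E; case: (W'P w0).
have Wd : W d by rewrite /d addrC -scaleN1r; apply: Wl => //; case: (W'P w0).
have [a a0 e1] := unit_scale d0; pose e0 := a *: d.
have We0 : W e0 by exact: subspace_scale.
have orth w : W' w -> hinner w e0 = 0.
  move=> W'w; rewrite ipZr ipBr; apply/eqP; rewrite mulf_eq0 subr_eq0; apply/orP; right.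
  rewrite {1}(esP w W'w) ip_suml [hinner w (P w0)]hinner_conj ip_suml rmorph_sum /=.
  apply/eqP; apply: eq_bigr => e _.
  by rewrite !ipZl rmorphM /= -!hinner_conj mulrC.
have orth' e : e \in es -> hinner e0 e = 0.
  by move=> /esW'[/orth E _]; rewrite hinner_conj E rmorph0.
exists (e0 :: es) => [e|w Ww].
  by rewrite inE => /predU1P[->|/esW'[[]]].
have [b bw] := Wspan _ Ww.
(* Modulo the span of [s], [w] is b v and [w0] is c v, so subtracting t times [w0] cancels [v];
   dividing by [a] undoes the normalisation of [e0]. *)
pose t := b / c; pose w' := w - t / a *: e0.
have W'w' : W' w'.
  have -> : w' = t *: P w0 + (w - t *: w0).
    rewrite /w' /e0 scalerA divfK // /d scalerBr opprB addrCA.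
    by congr (_ + _); rewrite addrC.
  apply: W'l => //; split.
    by rewrite addrC -scaleNr; apply: Wl.
  have -> : w - t *: w0 = - t *: (w0 - c *: v) + (w - b *: v).
    rewrite scalerBr scalerA mulNr divfK // !scaleNr opprK.
    by rewrite [RHS]addrC [- (t *: w0) + _]addrC addrA subrK.
  exact: lspan_lin.
have wE : w = t / a *: e0 + w' by rewrite /w' addrC subrK.
clearbody w'.
rewrite big_cons; have -> : hinner w e0 = t / a.
  by rewrite wE ipDl ipZl e1 mulr1 (orth w') // addr0.
rewrite {1}wE; congr (_ + _); rewrite {1}(esP w' W'w').
rewrite !big_seq; apply: eq_bigr => e ees.
by rewrite wE ipDl ipZl (orth' e) // mulr0 add0r.
Qed.

(** [parseval_basis] for the range of [x]. That the basis vectors are values of [x] shows that they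
    lie in [V], and that [x] fixes them when it is idempotent. *)
Lemma finrank_expansion (V : H -> Prop) (x : H -> H) : finrank_op V x ->
  exists2 es : seq H,
    forall e, e \in es -> hinner e e = 1 /\ exists u, e = x u
  & forall u, x u = \sum_(e <- es) hinner (x u) e *: e.
Proof.
move=> [[xl _] [s sP] _ _].
have [||w [u ->]|es esP esE] := @parseval_basis s (fun w => exists u, w = x u).
- by exists 0; rewrite (lin0 xl).
- by move=> a u v [u' ->] [v' ->]; exists (a *: u' + v'); rewrite xl.
- exact/lspanP.
exists es => [e /esP[]//|u]; apply: esE; by exists u.
Qed.

End FiniteRank.

(** * Atoms in a direct sum of finite-rank algebras *)

Section DirectSum.
Local Open Scope ring_scope.
Local Open Scope complex_scope.
Variables (R : realType) (I : Type) (K : I -> hilbert R).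

(** The match transports [x] along an equality of indices decided classically; proof irrelevance
    makes the transport trivial at [i]. *)
Definition single i (x : K i -> K i) j : K j -> K j :=
  if pselect (i = j) is left E then
    match E in _ = k return K k -> K k with erefl => x end
  else fun=> 0.

Lemma single_same i x : @single i x i = x.
Proof.
rewrite /single; case: pselect => [E|/(_ erefl)//].
by rewrite (Prop_irrelevance E erefl).
Qed.

Lemma single_other i x j : i <> j -> @single i x j = fun=> 0.
Proof. by rewrite /single; case: pselect. Qed.

Variable V : forall i, K i -> Prop.
Hypothesis Vdense : forall i, dense_subspace (@V i).

Lemma finrank_zero i : finrank_op (@V i) (fun=> 0).
Proof.
have [V0 _ _] := Vdense i; split=> //.
- apply/bounded_nsqP; split=> [a u v|]; first by rewrite scaler0 addr0.
  by exists 0 => // u; rewrite nsq0 mul0r.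
- by exists [::] => u; exists (fun=> 0); rewrite big_ord0.
- by exists (fun=> 0) => // u v; rewrite ip0l ip0r.
Qed.

Lemma single_proj i (e : K i) : @V i e -> hinner e e = 1 ->
  is_proj (DSops K) (dsum_F V) (single (fun u => hinner u e *: e)).
Proof.
move=> Ve e1; have [V0 Vl _] := Vdense i.
have ee : is_adj (fun u => hinner u e *: e) (fun u => hinner u e *: e).
  by move=> u v; rewrite ipZl ipZr -hinner_conj mulrC.
split.
- split=> [j|].
    have [<-|ij] := pselect (i = j); last by rewrite single_other //; exact: finrank_zero.
    rewrite single_same; split; first exact: bounded_proj1.
    + exists [:: e] => u; exists (fun=> hinner u e); by rewrite big_ord1.
    + by move=> u; apply: subspace_scale.
    + by exists (fun u => hinner u e *: e) => // u; apply: subspace_scale.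
  exists [:: i] => j ij; apply: single_other => E; apply: ij; left; exact: E.
- move=> j; have [<-|ij] := pselect (i = j); first by rewrite single_same.
  by rewrite single_other // => u v; rewrite ip0l ip0r.
- apply: functional_extensionality_dep => j /=.
  have [<-|ij] := pselect (i = j); last by rewrite single_other.
  by rewrite single_same; apply: funext => u; rewrite ipZl e1 mulr1.
Qed.

(** A projection [q] below this one is determined by [q i e]. Self-adjointness puts that vector on
    the line of [e], and idempotence leaves only the factors 0 and 1. *)
Lemma single_atom i (e : K i) : @V i e -> hinner e e = 1 ->
  is_atom (DSops K) (dsum_F V) (single (fun u => hinner u e *: e)).
Proof.
move=> Ve e1; split; first exact: single_proj.
  move=> /(congr1 (fun f : forall j, K j -> K j => f i e)).
  rewrite single_same e1 scale1r /= => e0; move: e1; rewrite e0 ip0l => /eqP.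
  by rewrite eq_sym oner_eq0.
move=> q [[qF _] qadj qq] qp qN0.
have qpE j u : q j (single (fun u => hinner u e *: e) u) = q j u by rewrite -{2}qp.
have qlin j : lin_op (q j) by have [[]] := qF j.
have qiE u : q i u = hinner u e *: q i e.
  by rewrite -qpE single_same (linZ (qlin i)).
set c := hinner (q i e) e.
have qe : q i e = c *: e.
  apply: ip_ext => u; rewrite (qadj i) qiE ipZr -hinner_conj ipZl mulrC.
  by rewrite -(qadj i).
have c01 : c = 0 \/ c = 1.
  have : q i (q i e) = q i e by rewrite -{3}qq.
  rewrite qe (linZ (qlin i)) qe scalerA => /(congr1 (fun w => hinner w e)).
  rewrite !ipZl e1 !mulr1 => /eqP; rewrite -subr_eq0 -{3}[c]mulr1 -mulrBr.
  by rewrite mulf_eq0 subr_eq0 => /orP[] /eqP; auto.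
have qother j : i <> j -> q j = fun=> 0.
  by move=> ij; apply: funext => u; rewrite -qpE single_other // (lin0 (qlin j)).
case: c01 => cE.
  case: qN0; apply: functional_extensionality_dep => j /=.
  have [<-|/qother//] := pselect (i = j); apply: funext => u.
  by rewrite qiE qe cE scale0r scaler0.
apply: functional_extensionality_dep => j /=.
have [<-|ij] := pselect (i = j); last by rewrite qother // single_other.
by rewrite single_same; apply: funext => u; rewrite qiE qe cE scale1r.
Qed.

Lemma dsum_foldrE (s : seq (forall i, K i -> K i)) j u :
  foldr (sa_add (DSops K)) (sa_zero (DSops K)) s j u = \sum_(q <- s) q j u.
Proof. by elim: s => [|q s IH] /=; rewrite ?big_nil // big_cons IH. Qed.

Lemma dsum_purely_atomic : purely_atomic (DSops K) (dsum_F V).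
Proof.
move=> p pproj; have [[pF [J JP]] _ _] := pproj.
suff [s sa sE] : exists2 s : seq (forall i, K i -> K i),
    forall q, List.In q s -> is_atom (DSops K) (dsum_F V) q
    & forall j u, p j u = \sum_(q <- s) q j u.
  exists s; split=> //; apply: functional_extensionality_dep => j.
  by apply: funext => u; rewrite dsum_foldrE.
elim: J p pproj {pF} JP => [|i J IH] p pproj JP.
  by exists [::] => // j u; rewrite big_nil JP.
have [[pF _] padj pp] := pproj.
(* Induction on the support: erasing the component at [i] leaves a projection supported in [J]. *)
pose p' j : K j -> K j := if pselect (i = j) then fun=> 0 else p j.
have p'J j : ~ List.In j J -> p' j = (fun=> 0).
  by rewrite /p'; case: pselect => //= ij jJ; apply: JP => -[].
have [|s sa sE] := IH p' _ p'J.
- split.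
  + split; last by exists J.
    by move=> j; rewrite /p'; case: pselect => ij; [exact: finrank_zero|exact: pF].
  + move=> j; rewrite /p' /=; case: pselect => ij u v /=.
      by rewrite ip0l ip0r.
    exact: padj.
  + apply: functional_extensionality_dep => j /=; rewrite /p'.
    case: pselect => // ij; exact: (congr1 (fun f : forall j, K j -> K j => f j) pp).
have [es esP esE] := finrank_expansion (pF i).
have esV e : e \in es -> @V i e /\ hinner e e = 1.
  by move=> /esP[e1 [u eu]]; split=> //; rewrite eu; have [] := pF i.
exists ([seq single (fun u => hinner u e *: e) | e <- es] ++ s).
  move=> q /(@List.in_app_or _ _ _ q)[|/sa//].
  elim: es esV {esP esE} => [//|e es IHes] esV /= [<-|].
    by have [] := esV _ (mem_head _ _); exact: single_atom.
  by apply: IHes => f fes; apply: esV; rewrite inE fes orbT.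
move=> j u; rewrite big_cat /= big_map -sE; move: u.
have [<-|ij] := pselect (i = j) => u.
  rewrite /p'; case: pselect => //= _; rewrite addr0.
  (* Hence the coefficient of p u on [e] is already the inner product of [u] and [e]. *)
  have fix_e e : e \in es -> p i e = e.
    by move=> /esP[_ [v ->]]; rewrite -{3}pp.
  rewrite {1}esE !big_seq; apply: eq_bigr => e ees.
  by rewrite single_same (padj i) fix_e.
rewrite /p'; case: pselect => //= _.
rewrite big1 ?add0r // => e _; by rewrite single_other.
Qed.

End DirectSum.

(** * The closure of a subspace as a Hilbert space *)

Section ClosedSubspace.
Local Open Scope ring_scope.
Local Open Scope complex_scope.
Variables (R : realType) (H : hilbert R).

Record subspace := Subspace {
  subspace_pred :> H -> Prop;
  subspace0 : subspace_pred 0;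
  subspaceP : forall (a : R[i]) (u v : H),
    subspace_pred u -> subspace_pred v -> subspace_pred (a *: u + v)
}.

Variable V : subspace.
Implicit Types u v : H.

Definition clo u : Prop :=
  forall eps : R, 0 < eps -> exists2 v, V v & nsq (u - v) < eps.

(** Boolean membership, through classical logic, from which the subtype [closed_sub] inherits its
    module structure. *)
Definition in_clo : {pred H} := fun u => `[< clo u >].

Lemma in_cloP u : reflect (clo u) (u \in in_clo).
Proof. exact: asboolP. Qed.

Lemma clo_sub u : V u -> clo u.
Proof. by move=> Vu eps e0; exists u; rewrite // subrr nsq0. Qed.

Lemma clo_clo u :
  (forall eps : R, 0 < eps -> exists2 v, clo v & nsq (u - v) < eps) -> clo u.
Proof.
move=> uP eps e0; have e4 : 0 < eps / 4 by rewrite divr_gt0.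
have [v cv uv] := uP _ e4; have [w Vw vw] := cv _ e4.
exists w => //; rewrite -[u](subrK v) -addrA.
by apply: (le_lt_trans (nsqD_le _ _)); lra.
Qed.

(** Continuity with a target subspace [S], for two uses: [S] equal to [V] gives stability of the
    closure, and [S] zero gives uniqueness of bounded extensions. *)
Lemma bounded_clo (S : subspace) (x : H -> H) : bounded_op x ->
  (forall v, V v -> S (x v)) ->
  forall u, clo u -> forall eps : R, 0 < eps ->
  exists2 w, S w & nsq (x u - w) < eps.
Proof.
move=> /bounded_nsqP[xl [m m0 xm]] VS u cu eps e0.
have m1 : 0 < m + 1 by rewrite ltr_wpDl.
have [v Vv uv] := cu (eps / (m + 1)) (divr_gt0 e0 m1).
exists (x v); first exact: VS.
rewrite -(linB xl).
apply: (le_lt_trans (xm _)); rewrite ltr_pdivlMr // in uv.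
apply: le_lt_trans uv; rewrite mulrC ler_wpM2l ?nsq_ge0 //; lra.
Qed.

Lemma clo_stable (x : H -> H) : bounded_op x ->
  (forall v, V v -> V (x v)) -> forall u, clo u -> clo (x u).
Proof.
move=> xb xV u cu; apply: clo_clo => eps e0.
by have [w Vw] := bounded_clo xb xV cu e0; exists w => //; exact: clo_sub.
Qed.

Lemma clo_ext (x y : H -> H) : bounded_op x -> bounded_op y ->
  (forall v, V v -> x v = y v) -> forall u, clo u -> x u = y u.
Proof.
move=> xb yb xyV u cu; apply/eqP; rewrite -subr_eq0 -nsq_eq0 eq_le nsq_ge0 andbT.
have db : bounded_op (fun u => x u + (-1) *: y u).
  by apply: bounded_add => //; exact: bounded_scale.
have S0 a (w w' : H) : 0 = w -> 0 = w' -> 0 = a *: w + w'.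
  by move=> <- <-; rewrite scaler0 addr0.
pose S := @Subspace (fun u => 0 = u) erefl S0.
apply/ler_addgt0Pr => eps e0; rewrite add0r.
have [v|w <-] := @bounded_clo S _ db _ u cu eps e0.
  by move=> /xyV ->; rewrite /= scaleN1r subrr.
by rewrite subr0 scaleN1r => /ltW.
Qed.

Lemma clo_submod : GRing.submod_closed in_clo.
Proof.
split=> [|a u v /in_cloP cu /in_cloP cv].
  exact/in_cloP/clo_sub/subspace0.
apply/in_cloP/clo_clo => eps e0.
pose c := complex.Re (a * conjc a).
have c0 : 0 <= c by rewrite -ler0c RRe_real ?ger0_real // mulcJ_ge0.
have c1 : 0 < c + 1 by rewrite ltr_wpDl.
have [u' Vu uu] := cu (eps / 4 / (c + 1)) (divr_gt0 (divr_gt0 e0 (ltr0n _ 4)) c1).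
have [v' Vv vv] := cv (eps / 4) (divr_gt0 e0 (ltr0n _ 4)).
exists (a *: u' + v'); first exact/clo_sub/subspaceP.
rewrite opprD addrACA -scalerBr; apply: (le_lt_trans (nsqD_le _ _)).
rewrite nsqZ -/c; rewrite ltr_pdivlMr // in uu.
have := nsq_ge0 (u - u'); nra.
Qed.

HB.instance Definition _ :=
  GRing.isSubmodClosed.Build R[i] (hcar H) in_clo clo_submod.

Record closed_sub := ClosedSub { cval :> H; cvalP : cval \in in_clo }.

HB.instance Definition _ := [isSub for cval].
HB.instance Definition _ := [Choice of closed_sub by <:].
HB.instance Definition _ := [SubChoice_isSubLmodule of closed_sub by <:].

Definition cinner (u v : closed_sub) : R[i] := hinner (cval u) (cval v).

Lemma cvalD (u v : closed_sub) : cval (u + v) = cval u + cval v.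
Proof. exact: (raddfD (val : closed_sub -> H)). Qed.
Lemma cvalB (u v : closed_sub) : cval (u - v) = cval u - cval v.
Proof. exact: (raddfB (val : closed_sub -> H)). Qed.
Lemma cvalZ a (u : closed_sub) : cval (a *: u) = a *: cval u.
Proof. by []. Qed.
Lemma cval0 : cval 0 = 0.
Proof. exact: (raddf0 (val : closed_sub -> H)). Qed.

Lemma cvalK (u : closed_sub) : clo (cval u).
Proof. exact/in_cloP/cvalP. Qed.

Lemma cval_inj : injective cval.
Proof. exact: val_inj. Qed.

Lemma cinner_complete (s : nat -> closed_sub) :
  cauchy_seq cinner s -> exists l, converges_to cinner s l.
Proof.
move=> sC; have [eps e0|l lP] := hcomplete (u := cval \o s).
  have [N NP] := sC _ e0; exists N => m n Nm Nn /=.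
  by rewrite -cvalB; apply: NP.
suff cl : clo l.
  exists (ClosedSub (introT (in_cloP l) cl)) => eps /lP[N NP].
  by exists N => n /NP; rewrite /cinner cvalB.
apply: clo_clo => eps e0; have [|N NP] := lP eps%:C; first by rewrite ltcR.
exists (cval (s N)); first exact: cvalK.
by rewrite -nsqN opprB -ltcR -nsqE; apply: NP.
Qed.

(** Transparent, so that carrier and inner product unfold to [closed_sub] and [cinner]. *)
Definition closed_hilbert : hilbert R.
Proof.
apply: (@Hilbert R closed_sub cinner).
- by move=> a x1 x2 y; rewrite /cinner cvalD cvalZ hinner_linl.
- by move=> x y; exact: hinner_conj.
- by move=> x; exact: hinner_ge0.
- by move=> x /hinner_def x0; apply: cval_inj; rewrite x0 cval0.
- exact: cinner_complete.
Defined.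

Lemma closed_hilbert_dense :
  dense_subspace (H := closed_hilbert) (fun u : closed_sub => V (cval u)).
Proof.
split=> [|a u v Vu Vv|u eps].
- by rewrite cval0; exact: subspace0.
- by rewrite cvalD cvalZ; exact: subspaceP.
(* In the order of the complex numbers, a positive [eps] has zero imaginary part and positive real
   part. *)
rewrite ltcE => /andP[/eqP im0 e0]; have [v Vv uv] := cvalK u e0.
exists (ClosedSub (introT (in_cloP v) (clo_sub Vv))) => //=.
by rewrite /cinner cvalB /= nsqE ltcE /= im0 eqxx.
Qed.

End ClosedSubspace.

(** * Support projections in an R*-algebra *)

Section RstarAlgebra.
Local Open Scope ring_scope.
Local Open Scope complex_scope.
Variables (R : realType) (H : hilbert R) (A : (H -> H) -> Prop).
Hypothesis RA : Rstar_alg A.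
Implicit Types (u v w : H) (x y a b p q e : H -> H).

Lemma alg_bounded x : A x -> bounded_op x.
Proof. by case: RA => -[h _] _; exact: h. Qed.

Lemma alg_lin x : A x -> lin_op x.
Proof. by move=> /alg_bounded[]. Qed.

Lemma alg0 : A (fun=> 0).
Proof. by case: RA => -[_ [h _]] _. Qed.

Lemma algD x y : A x -> A y -> A (fun u => x u + y u).
Proof. by case: RA => -[_ [_ [h _]]] _; exact: h. Qed.

Lemma algZ c x : A x -> A (fun u => c *: x u).
Proof. by case: RA => -[_ [_ [_ [h _]]]] _; exact: h. Qed.

Lemma algM x y : A x -> A y -> A (x \o y).
Proof. by case: RA => -[_ [_ [_ [_ [h _]]]]] _; exact: h. Qed.

Lemma alg_adj x : A x -> exists2 y, A y & is_adj x y.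
Proof. by case: RA => -[_ [_ [_ [_ [_ h]]]]] _; exact: h. Qed.

Lemma alg_annihil x : A x -> is_adj x x ->
  exists s, forall u, root_prod x s u = 0.
Proof.
move=> Ax xx; apply: (finite_spectrum_annihil (alg_lin Ax) (alg_bounded Ax) xx).
by case: RA => _ h; exact: h.
Qed.

(* A polynomial annihilating [x] is a power of [X] times [c - X k] with
   [c <> 0], and self-adjointness reduces the power to one. *)
Lemma annihil_split x s : A x -> is_adj x x -> exists c k,
  [/\ c != 0, lin_op k, forall u, k (x u) = x (k u), A (x \o k) &
      forall u, root_prod x s u = 0 -> x (c *: u - x (k u)) = 0].
Proof.
move=> Ax xx; have xl := alg_lin Ax.
elim: s => [|t s [c [k [c0 kl kx Axk kP]]]].
  exists 1, (fun=> 0); split; rewrite ?oner_eq0 //.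
  - by move=> d u v; rewrite scaler0 addr0.
  - by move=> u; rewrite (lin0 xl).
  - by have := alg0; congr A; apply: funext => u /=; rewrite (lin0 xl).
  - by move=> u /= ->; rewrite scaler0 !(lin0 xl) subr0 (lin0 xl).
(* A root 0 adds only a second factor [x], and x x w = 0 already gives x w = 0 for self-adjoint
   [x]. *)
have [t0|t0] := eqVneq t 0.
  exists c, k; split=> // u /=; rewrite t0 scale0r subr0 -root_prod_self // => /kP.
  rewrite kx -(linZ xl) -(linB xl) => E; apply: hinner_def.
  by rewrite xx E ip0r.
(* From (c - X k)(X - t) = - c t - X (- c + k (X - t)). The new [k] contains a multiple of the
   identity, possibly missing from [A]; so only [x \o k] is claimed to lie in [A]. *)
exists (- (c * t)), (fun u => - c *: u + (k (x u) - t *: k u)); split.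
- by rewrite oppr_eq0 mulf_neq0.
- move=> d u v; rewrite xl !kl [t *: (_ + _)]scalerDr opprD.
  rewrite [X in _ + X = _]addrACA [- c *: (_ + _)]scalerDr [LHS]addrACA.
  rewrite !scalerA [- c * d]mulrC [t * d]mulrC -!scalerA. rewrite -scalerBr.
  by rewrite -scalerDr.
- by move=> u; rewrite (linD xl) (linB xl) !(linZ xl) !kx.
- have := algD (algZ (- c) Ax) (algD (algM Axk Ax) (algZ (- t) Axk)).
  suff -> : x \o (fun u => - c *: u + (k (x u) - t *: k u)) =
    (fun u => - c *: x u + (((x \o k) \o x) u + - t *: (x \o k) u)) by [].
  apply: funext => u /=.
  by rewrite (linD xl) (linB xl) !(linZ xl) !scaleNr.
move=> u /=; rewrite -root_prod_self // -(linZ (root_prod_lin xl s)).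
rewrite -(linB (root_prod_lin xl s)).
move=> /kP; rewrite (linB kl) (linZ kl) => <-; congr (x _).
rewrite !(linD xl) (linN xl) !(linZ xl) !scaleNr !opprD !opprK scalerBr scalerA.
by rewrite addrA [- _ + c *: _]addrC.
Qed.

(** Since x (c - x k) = 0, e = c^-1 x k satisfies x e = x. Taking adjoints, e^* fixes the range of
    [x], which contains that of [e]; so e^* e = e, and [e] is a projection. *)
Lemma support_proj x : A x -> is_adj x x -> exists e k,
  [/\ is_proj (Bops H) A e, forall u, e u = x (k u) & forall u, x (e u) = x u].
Proof.
move=> Ax xx; have xl := alg_lin Ax; have [s s0] := alg_annihil Ax xx.
have [c [k [c0 kl kx Axk kP]]] := annihil_split s Ax xx.
pose e u := c^-1 *: x (k u); exists e, (fun u => c^-1 *: k u).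
have Ae : A e by exact: algZ.
have ek u : e u = x (c^-1 *: k u) by rewrite (linZ xl).
have xe u : x (e u) = x u.
  have /eqP := kP u (s0 u); rewrite (linB xl) (linZ xl) subr_eq0 => /eqP E.
  by rewrite /e (linZ xl) -E scalerA mulVf // scale1r.
have [y Ay ey] := alg_adj Ae.
have yx v : y (x v) = x v.
  by apply: ip_extr => u; rewrite -ey -xx xe xx.
have ee u v : hinner (e u) (e v) = hinner u (e v).
  by rewrite ey [e v]ek yx.
have eadj : is_adj e e by move=> u v; rewrite -ee !(hinner_conj _ (e u)) ee.
split=> //; split=> //.
by apply: funext => u; apply: ip_ext => v /=; rewrite eadj ee eadj.
Qed.

Lemma proj_alg p : is_proj (Bops H) A p -> A p. Proof. by case. Qed.
Lemma proj_adj p : is_proj (Bops H) A p -> is_adj p p. Proof. by case. Qed.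
Lemma proj_idem p u : is_proj (Bops H) A p -> p (p u) = p u.
Proof. by case=> _ _ /(congr1 (@^~ u)). Qed.

(** * Corners of atoms are scalar *)

Local Notation atom := (is_atom (Bops H) A).

Lemma atom_proj p : atom p -> is_proj (Bops H) A p. Proof. by case. Qed.

Lemma atom_unit p : atom p -> exists2 v, p v = v & hinner v v = 1.
Proof.
move=> [pp p0 _]; have [v pv] : exists v, p v != 0.
  apply: contrapT => /forallNP E; apply: p0; apply: funext => v /=.
  by apply/eqP; apply: contrapT => /negP /E.
have [c c0 e1] := unit_scale pv; exists (c *: p v) => //.
by rewrite (linZ (alg_lin (proj_alg pp))) proj_idem.
Qed.

(** The support projection of [x] lies below [p], so it is 0 or [p] by minimality; it kills [v] as
    [x] does, whereas [p] fixes [v]. *)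
Lemma corner_eq0 p x v : atom p -> A x -> is_adj x x ->
  (forall u, p (x u) = x u) -> p v = v -> v != 0 -> x v = 0 ->
  forall u, x u = 0.
Proof.
move=> [pp _ pmin] Ax xx px pv v0 xv; have padj := proj_adj pp.
have [e [k [eproj ek xe]]] := support_proj Ax xx; have eadj := proj_adj eproj.
have [e0|eN0] := pselect (e = fun=> 0).
  by move=> u; rewrite -xe e0 (lin0 (alg_lin Ax)).
have eqp : e = p.
  apply: pmin => //; apply: funext => u; apply: ip_ext => w /=.
  by rewrite eadj padj ek px -ek eadj.
have ev : e v = 0.
  by apply: hinner_def; rewrite -eadj proj_idem // eadj ek -xx xv ip0l.
by move: v0; rewrite -pv -eqp ev eqxx.
Qed.

(** Given an eigenvector of [x] in the range of [p], with eigenvalue c, real by self-adjointness,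
    [corner_eq0] applies to x - c p. *)
Lemma corner_scalar_adj p x : atom p -> A x -> is_adj x x ->
  (forall u, p (x u) = x u) -> exists c, forall u, x u = c *: p u.
Proof.
move=> pat Ax xx px; have pp := atom_proj pat; have padj := proj_adj pp.
have pl := alg_lin (proj_alg pp); have xl := alg_lin Ax.
have [v pv v1] := atom_unit pat; have [s /(_ v) sv0] := alg_annihil Ax xx.
have v0 : v != 0.
  by apply/eqP => v0; move: v1; rewrite v0 ip0l => /eqP; rewrite eq_sym oner_eq0.
(* The annihilating product, applied to [v] factor by factor, reaches 0; the last nonzero value is
   an eigenvector, still in the range of [p]. *)
have [c [w [w0 pw xw]]] : exists c w, [/\ w != 0, p w = w & x w = c *: w].
  elim: s sv0 => [/= E|t s IH]; first by rewrite E eqxx in v0.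
  have [/IH//|n0 /= /eqP] := eqVneq (root_prod x s v) 0; rewrite subr_eq0 => /eqP E.
  exists t, (root_prod x s v); split=> //.
  by elim: s {IH E n0} => //= r s IH; rewrite (linB pl) (linZ pl) px IH.
have cJ : conjc c = c.
  have := xx w w; rewrite xw ipZl ipZr => /(congr1 (fun z => z / hinner w w)).
  rewrite !mulfK //; apply: contra_neq w0; exact: hinner_def.
exists c => u; apply/eqP; rewrite -subr_eq0 -scaleNr; apply/eqP; move: u.
apply: (corner_eq0 (x := fun u => x u + - c *: p u) (v := w) pat) => //.
- by apply: algD => //; apply: algZ; exact: proj_alg.
- move=> u v'; rewrite ipDl ipDr xx ipZl ipZr padj; congr (_ + _ * _).
  by rewrite rmorphN /= cJ.
- by move=> u; rewrite (linD pl) (linZ pl) px proj_idem.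
- by rewrite xw pw scaleNr subrr.
Qed.

(** With [j] an imaginary unit, p x p + p x^* p and j (p x p - p x^* p) are self-adjoint, hence
    scalar, and they determine p x p. *)
Lemma corner_scalar p x : atom p -> A x ->
  exists c, forall u, p (x (p u)) = c *: p u.
Proof.
move=> pat Ax; have pp := atom_proj pat; have padj := proj_adj pp.
have Ap := proj_alg pp; have pl := alg_lin Ap.
have [y Ay xy] := alg_adj Ax.
have Ac z : A z -> A (p \o z \o p) by move=> Az; do 2!apply: algM => //.
have [j jJ jj] : exists2 j : R[i], conjc j = - j & j * j = -1.
  exists 'i%C; last by rewrite -expr2 sqr_i.
  by apply/eqP; rewrite eq_complex /= oppr0 !eqxx.
have yx := is_adj_sym xy.
have [c cP] : exists c, forall u, p (x (p u)) + p (y (p u)) = c *: p u.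
  apply: corner_scalar_adj => //.
  - exact: algD (Ac _ Ax) (Ac _ Ay).
  - by move=> u v; rewrite ipDl ipDr !padj xy yx !padj addrC.
  - by move=> u; rewrite (linD pl) !(proj_idem _ pp).
have [d dP] : exists d, forall u,
    j *: p (x (p u)) + - j *: p (y (p u)) = d *: p u.
  apply: corner_scalar_adj => //.
  - exact: algD (algZ _ (Ac _ Ax)) (algZ _ (Ac _ Ay)).
  - move=> u v; rewrite ipDl ipDr !ipZl !ipZr rmorphN /= jJ opprK.
    by rewrite !padj xy yx !padj addrC.
  - by move=> u; rewrite (linD pl) !(linZ pl) !(proj_idem _ pp).
exists ((c - j * d) / 2%:R) => u.
have -> : (c - j * d) / 2%:R = 2%:R^-1 * (c - j * d) by rewrite mulrC.
rewrite -scalerA scalerBl -cP -scalerA -dP [j *: (_ + _)]scalerDr.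
rewrite ![j *: (_ *: _)]scalerA mulrN jj opprK scaleN1r scale1r.
rewrite opprD opprK addrACA subrr addr0.
by rewrite -mulr2n -(scaler_nat 2 (p (x (p u)))) scalerA mulVf ?scale1r // pnatr_eq0.
Qed.

Lemma corner_coef p x v : atom p -> A x -> p v = v -> hinner v v = 1 ->
  forall u, p (x (p u)) = hinner (x v) v *: p u.
Proof.
move=> pat Ax pv v1 u; have [c cP] := corner_scalar pat Ax.
suff -> : hinner (x v) v = c by [].
have := cP v; rewrite pv => /(congr1 (fun w => hinner w v)).
by rewrite ipZl v1 mulr1 (proj_adj (atom_proj pat)) pv.
Qed.

(** * Linked atoms and their classes *)

Definition linked p q := exists2 a, A a & exists u, p (a (q u)) <> 0.

(** Take b' = b^*: p b q b^* p is a multiple of [p], and if it vanished, so would q b^* p and its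
    adjoint p b q. In effect [p] factors through [q]. *)
Lemma linked_coef p q : atom p -> is_proj (Bops H) A q -> linked p q ->
  exists b b' c, [/\ A b, A b', c != 0 &
    forall u, p (b (q (b' (p u)))) = c *: p u].
Proof.
move=> pat qq [b Ab [u pbq]]; have [b' Ab' bb] := alg_adj Ab.
have pp := atom_proj pat; have padj := proj_adj pp; have qadj := proj_adj qq.
have [c cP] := corner_scalar pat (algM Ab (algM (proj_alg qq) Ab')).
exists b, b', c; split=> //; apply/eqP => c0; apply: pbq.
apply: ip_ext => v; rewrite padj bb qadj.
suff -> : q (b' (p v)) = 0 by rewrite ip0l ip0r.
apply: hinner_def; rewrite qadj proj_idem // (is_adj_sym bb) padj.
by rewrite [p (b _)]cP c0 scale0r ip0r.
Qed.

Lemma linked_refl p : atom p -> linked p p.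
Proof.
move=> pat; have pp := atom_proj pat; exists p; first exact: proj_alg.
have [v pv v1] := atom_unit pat; exists v; rewrite !pv => v0.
by move: v1; rewrite v0 ip0l => /eqP; rewrite eq_sym oner_eq0.
Qed.

Lemma linked_sym p q : is_proj (Bops H) A p -> is_proj (Bops H) A q ->
  linked p q -> linked q p.
Proof.
move=> pp qq [a Aa [u paq]]; have [b Ab ab] := alg_adj Aa.
exists b => //; apply: contrapT => /forallNP E; apply: paq.
apply: ip_ext => v; rewrite (proj_adj pp) ab (proj_adj qq).
by rewrite (contrapT (E v)) ip0l ip0r.
Qed.

(** As [q] is an atom, it is a nonzero multiple of q b r b' q; inserting this in p a q gives a
    nonzero product ending in [r] b' q. *)
Lemma linked_trans p q r : atom q -> is_proj (Bops H) A p ->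
  is_proj (Bops H) A r -> linked p q -> linked q r -> linked p r.
Proof.
move=> qat pp rr [a Aa [u paq]] qr.
have [b [b' [c [Ab Ab' c0 cP]]]] := linked_coef qat rr qr.
have qA := proj_alg (atom_proj qat).
exists (a \o (q \o b)); first by do 2!apply: algM => //.
exists (b' (q u)) => /=; rewrite cP (linZ (alg_lin Aa)) (linZ (alg_lin (proj_alg pp))).
by move=> /eqP; rewrite scaler_eq0 (negPf c0) /= => /eqP.
Qed.

(** The choice depends only on the predicate, so atoms linked to the same atoms get equal
    representatives. *)
Definition pick_op (P : (H -> H) -> Prop) : H -> H :=
  if pselect (exists q, P q) is left E then sval (cid E) else fun=> 0.

Definition atom_rep p := pick_op (fun q => atom q /\ linked p q).

Lemma atom_repP p : atom p -> atom (atom_rep p) /\ linked p (atom_rep p).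
Proof.
move=> pat; rewrite /atom_rep /pick_op; case: pselect => [E|[]].
  exact: (svalP (cid E)).
by exists p; split=> //; exact: linked_refl.
Qed.

Lemma atom_rep_eq p q : atom p -> atom q -> linked p q -> atom_rep p = atom_rep q.
Proof.
move=> pat qat pq; rewrite /atom_rep; congr pick_op; apply: funext => r.
have [pp qq] := (atom_proj pat, atom_proj qat); apply: propext.
split=> -[rat l]; split=> //; have rr := atom_proj rat.
  by apply: linked_trans (linked_sym pp qq pq) l.
exact: linked_trans pq l.
Qed.

(** The fixed points of [atom_rep] stand for the quotient of the atoms by the relation [linked]. *)
Definition atom_class := {p : H -> H | atom p /\ atom_rep p = p}.

Lemma atom_class_of p : atom p -> exists i : atom_class, linked p (sval i).
Proof.
move=> pat; have [rat l] := atom_repP pat.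
by exists (exist _ (atom_rep p) (conj rat (esym (atom_rep_eq pat rat l)))).
Qed.

Lemma atom_class_atom (i : atom_class) : atom (sval i). Proof. by case: i => p []. Qed.

Lemma atom_class_eq (i j : atom_class) : linked (sval i) (sval j) -> i = j.
Proof.
move=> l; have := atom_rep_eq (atom_class_atom i) (atom_class_atom j) l.
rewrite (proj2 (svalP i)) (proj2 (svalP j)).
case: i j {l} => [p pP] [q qP] /= E; subst q.
by congr exist; exact: Prop_irrelevance.
Qed.

(** * Orbits of the class vectors *)

Definition class_vec (i : atom_class) : H := s2val (cid2 (atom_unit (atom_class_atom i))).

Lemma class_vec_fix i : sval i (class_vec i) = class_vec i.
Proof. exact: (s2valP (cid2 (atom_unit (atom_class_atom i)))). Qed.

Lemma class_vec_unit i : hinner (class_vec i) (class_vec i) = 1.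
Proof. exact: (s2valP' (cid2 (atom_unit (atom_class_atom i)))). Qed.

Definition orbit_pred i u := exists2 a, A a & u = a (class_vec i).

Lemma orbit0 i : orbit_pred i 0.
Proof. by exists (fun=> 0); first exact: alg0. Qed.

Lemma orbitP i c u v :
  orbit_pred i u -> orbit_pred i v -> orbit_pred i (c *: u + v).
Proof.
move=> [a Aa ->] [b Ab ->]; exists (fun u => c *: a u + b u) => //.
by apply: algD => //; exact: algZ.
Qed.

Definition orbit i := Subspace (@orbit0 i) (@orbitP i).

Lemma orbit_alg i x u : A x -> orbit i u -> orbit i (x u).
Proof. by move=> Ax [a Aa ->]; exists (x \o a) => //; exact: algM. Qed.

Lemma orbit_clo i x u : A x -> clo (orbit i) u -> clo (orbit i) (x u).
Proof.
move=> Ax; apply: (@clo_stable _ _ (orbit i) x (alg_bounded Ax)) => v.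
exact: orbit_alg.
Qed.

(** On a xi, with xi = p xi, the value is p a p xi, a multiple of xi given by [corner_coef];
    boundedness extends this to the closure. *)
Lemma atom_class_on_orbit i u :
  clo (orbit i) u -> sval i u = hinner u (class_vec i) *: class_vec i.
Proof.
have iat := atom_class_atom i; have iA := proj_alg (atom_proj iat).
move: u; apply: (@clo_ext _ _ (orbit i)) => [||v [a Aa ->]].
- exact: alg_bounded.
- exact/bounded_proj1/class_vec_unit.
rewrite -{1}[class_vec i]class_vec_fix.
rewrite (corner_coef iat Aa (class_vec_fix i) (class_vec_unit i)).
by rewrite class_vec_fix.
Qed.

Lemma atom_on_orbit0 q i u : ~ linked q (sval i) -> A q -> clo (orbit i) u -> q u = 0.
Proof.
move=> nl Aq.
apply: (@clo_ext _ _ (orbit i) q (fun=> 0) (alg_bounded Aq) (alg_bounded alg0)).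
move=> v [a Aa ->]; apply: contrapT => qa; apply: nl; exists a => //.
by exists (class_vec i); rewrite class_vec_fix.
Qed.

(** If linked to the class atom, [q] factors through it, and that atom has rank one on the closure;
    otherwise [q] vanishes there. So x q has rank at most one, with range spanned by an orbit
    vector. *)
Lemma atom_on_orbit q i x : atom q -> A x -> exists2 v, orbit i v &
  forall u, clo (orbit i) u -> exists c, x (q u) = c *: v.
Proof.
move=> qat Ax; have qA := proj_alg (atom_proj qat).
have [l|nl] := pselect (linked q (sval i)); last first.
  exists 0; first exact: subspace0.
  move=> u cu; exists 0; rewrite (atom_on_orbit0 nl qA cu).
  by rewrite (lin0 (alg_lin Ax)) scaler0.
have [b [b' [c [Ab Ab' c0 cP]]]] := linked_coef qat (atom_proj (atom_class_atom i)) l.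
exists (x (q (b (class_vec i)))).
  by do 2!apply: orbit_alg => //; exists b.
move=> u cu; pose w := b' (q u).
have cw : clo (orbit i) w by do 2!apply: orbit_clo => //.
exists (c^-1 * hinner w (class_vec i)).
have -> : q u = c^-1 *: (q (b (sval i w))) by rewrite cP scalerA mulVf // scale1r.
rewrite (atom_class_on_orbit cw) (linZ (alg_lin Ab)) (linZ (alg_lin qA)).
by rewrite !(linZ (alg_lin Ax)) scalerA.
Qed.

(** * Finite decompositions and faithfulness *)

Hypothesis Aatomic : purely_atomic (Bops H) A.

(** For [e] the support projection of x^* x, x^* x (1 - e) = 0 forces x = x e, and [e] is a sum of
    atoms. *)
Lemma alg_decomp x : A x -> exists2 s : seq (H -> H),
  forall q, List.In q s -> atom q & forall u, x u = \sum_(q <- s) x (q u).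
Proof.
move=> Ax; have [y Ay xy] := alg_adj Ax; have xl := alg_lin Ax.
have yxA : is_adj (y \o x) (y \o x).
  by move=> u v /=; rewrite (is_adj_sym xy) xy.
have [e [k [eproj _ eP]]] := support_proj (algM Ay Ax) yxA.
have xe u : x u = x (e u).
  apply/eqP; rewrite -subr_eq0 -(linB xl); apply/eqP/hinner_def.
  by rewrite xy (linB xl) (linB (alg_lin Ay)) [y (x (e u))]eP subrr ip0r.
have [s [sat eE]] := Aatomic eproj; exists s => // u.
rewrite xe -(lin_sum xl); congr (x _); rewrite eE /=.
by elim: s {sat eE} => [|q s IH] /=; rewrite ?big_nil // big_cons IH.
Qed.

Lemma alg_ext0 x : A x ->
  (forall i u, clo (orbit i) u -> x u = 0) -> forall u, x u = 0.
Proof.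
move=> Ax x0 u; have [s sat ->] := alg_decomp Ax.
have xl := alg_lin Ax.
elim: s sat => [|q s IH] sat; first by rewrite big_nil.
rewrite big_cons IH ?addr0; last by move=> r rs; apply: sat; right.
have qat : atom q by apply: sat; left.
have [i l] := atom_class_of qat; have iat := atom_class_atom i; have iP := atom_proj iat.
have qA := proj_alg (atom_proj qat); have iA := proj_alg iP.
have [b [b' [c [Ab Ab' c0 cP]]]] := linked_coef qat iP l.
pose g := x \o (q \o b); have Ag : A g by do 2!apply: algM => //.
have [h Ah gh] := alg_adj Ag.
(* For p the class atom, p g^* g p is [p] times a coefficient computed at the class vector, where
   [g] vanishes by assumption; hence g p = 0. *)
have gp v : g (sval i v) = 0.
  apply: hinner_def; rewrite gh (proj_adj iP) -[h _]/((h \o g) (sval i v)).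
  rewrite (corner_coef iat (algM Ah Ag) (class_vec_fix i) (class_vec_unit i)) /=.
  have -> : g (class_vec i) = 0.
    apply: (x0 i); apply/clo_sub/(orbit_alg (algM qA Ab)).
    by exists (sval i) => //; rewrite class_vec_fix.
  by rewrite (lin0 (alg_lin Ah)) ip0l scale0r ip0r.
have -> : q u = c^-1 *: (q (b (sval i (b' (q u))))).
  by rewrite cP scalerA mulVf // scale1r.
by rewrite (linZ xl) [x _]gp scaler0.
Qed.

(** * The restriction isomorphism *)

Definition class_hilbert i : hilbert R := closed_hilbert (orbit i).
Local Notation K := class_hilbert.

Definition class_orbit i : K i -> Prop :=
  fun u : closed_sub (orbit i) => orbit i (cval u).
Local Notation V := class_orbit.

(* Junk value [0] where [x] leaves the closure; this does not happen for [x] in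
   [A]. *)
Definition restrict x i : K i -> K i := fun u : closed_sub (orbit i) =>
  if pselect (clo (orbit i) (x (cval u))) is left cl
  then ClosedSub (introT (in_cloP _ _) cl) else 0.

Lemma restrictE x i (u : K i) : A x -> cval (restrict x u) = x (cval u).
Proof.
move=> Ax; rewrite /restrict; case: pselect => // -[].
exact: orbit_clo (cvalK u).
Qed.

Lemma restrict_bounded x i : A x -> bounded_op (restrict x (i := i)).
Proof.
move=> Ax; have /bounded_nsqP[xl [m m0 xm]] := alg_bounded Ax.
apply/bounded_nsqP; split=> [c u v|].
  apply: cval_inj; rewrite restrictE // !cvalD !cvalZ !restrictE //; exact: xl.
exists m => // u; rewrite /nsq /= /cinner restrictE //; exact: xm.
Qed.

Lemma restrict_adj x y i : A x -> A y -> is_adj x y ->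
  is_adj (restrict x (i := i)) (restrict y (i := i)).
Proof. by move=> Ax Ay xy u v; rewrite /= /cinner !restrictE. Qed.

Lemma restrict_span x i : A x -> exists vs : seq (K i),
  forall u : K i, lspan vs (restrict x u) /\ V (restrict x u).
Proof.
move=> Ax; have [s sat sE] := alg_decomp Ax.
(* The partial sums are built as vectors of [K i]; each atom adds one vector to the spanning
   list. *)
suff [vs vsP] : exists vs : seq (K i), forall u : K i, exists y : K i,
    [/\ cval y = \sum_(q <- s) x (q (cval u)), lspan vs y & V y].
  exists vs => u; have [y [yE yspan Vy]] := vsP u.
  suff -> : restrict x u = y by [].
  by apply: cval_inj; rewrite restrictE // yE sE.
elim: s sat {sE} => [|q s IH] sat.
  exists [::] => u; exists 0; split=> //; first by rewrite cval0 big_nil.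
  by rewrite /class_orbit cval0; exact: subspace0.
have [|vs vsP] := IH; first by move=> r rs; apply: sat; right.
have qat : atom q by apply: sat; left.
have [v Vv vP] := atom_on_orbit i qat Ax.
pose v' : K i := ClosedSub (introT (in_cloP _ _) (clo_sub Vv)).
exists (v' :: vs) => u; have [y [yE yspan Vy]] := vsP u.
have [c cE] := vP _ (cvalK u); exists (c *: v' + y); split.
- by rewrite big_cons cvalD cvalZ /= yE cE.
- by exists c; rewrite addrC addKr.
- by rewrite /class_orbit cvalD cvalZ; exact: subspaceP.
Qed.

Lemma restrict_finrank x i : A x -> finrank_op (@V i) (restrict x (i := i)).
Proof.
move=> Ax; have [y Ay xy] := alg_adj Ax.
have [vs vsP] := restrict_span i Ax; have [ws wsP] := restrict_span i Ay.
split; first exact: restrict_bounded.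
- by exists vs => u; apply/lspanP; case: (vsP u).
- by move=> u; case: (vsP u).
- exists (restrict y (i := i)); first exact: restrict_adj.
  by move=> u; case: (wsP u).
Qed.

(** Each atom of the decomposition vanishes on all orbits but that of its class, so one index per
    atom suffices. *)
Lemma restrict_support x : A x -> exists J : seq atom_class,
  forall i, ~ List.In i J -> restrict x (i := i) = fun=> 0.
Proof.
move=> Ax; have [s sat sE] := alg_decomp Ax.
suff [J JP] : exists J : seq atom_class, forall i, ~ List.In i J ->
    forall u, clo (orbit i) u -> \sum_(q <- s) x (q u) = 0.
  exists J => i iJ; apply: funext => u; apply: cval_inj.
  by rewrite restrictE // cval0 sE (JP i iJ) //; exact: cvalK.
elim: s sat {sE} => [|q s IH] sat.
  by exists [::] => i _ u _; rewrite big_nil.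
have [|J JP] := IH; first by move=> r rs; apply: sat; right.
have qat : atom q by apply: sat; left.
have [j l] := atom_class_of qat; exists (j :: J) => i iJ u cu.
have iJ' : ~ List.In i J by move=> ?; apply: iJ; right.
rewrite big_cons (JP i iJ' u cu).
rewrite (@atom_on_orbit0 q i) ?(lin0 (alg_lin Ax)) ?addr0 //.
  move=> li; apply: iJ; left; apply: atom_class_eq.
  have [[jp ip] qp] :=
    (atom_proj (atom_class_atom j), atom_proj (atom_class_atom i), atom_proj qat).
  exact: linked_trans qat jp ip (linked_sym qp jp l) li.
exact/proj_alg/atom_proj.
Qed.

Lemma restrict_dsum x : A x -> dsum_F V (restrict x).
Proof.
move=> Ax; split=> [i|]; first exact: restrict_finrank.
exact: restrict_support.
Qed.

Lemma restrict_lift1 i (z : K i -> K i) : finrank_op (@V i) z ->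
  exists x, [/\ A x, forall u : K i, x (cval u) = cval (z u) &
    forall j (u : K j), i <> j -> x (cval u) = 0].
Proof.
move=> zF; have [es esP esE] := finrank_expansion zF.
have [_ _ zV [y zy yV]] := zF.
have {esP} esV (f : K i) : f \in es -> V f by move=> /esP[_ [u ->]].
suff [x [Ax xE x0]] : exists x, [/\ A x,
    forall u : K i, x (cval u) = cval (\sum_(f <- es) hinner (z u) f *: f) &
    forall j (u : K j), i <> j -> x (cval u) = 0].
  by exists x; split=> // u; rewrite xE -esE.
elim: es esV {esE} => [|e es IH] esV.
  exists (fun=> 0); split=> //; first exact: alg0.
  by move=> u; rewrite big_nil cval0.
have [|x [Ax xE x0]] := IH; first by move=> f fes; apply: esV; rewrite inE fes orbT.
have [a Aa aE] := esV e (mem_head _ _).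
have [b Ab bE] := yV e; have [b' Ab' bb] := alg_adj Ab.
have iA := proj_alg (atom_proj (atom_class_atom i)).
(* As e = a xi and the adjoint [y] of [z] sends [e] to b xi, the coefficient of a p b^* u on [e] is
   that of u against y e, that is, of z u against [e]. *)
exists (fun u => a (sval i (b' u)) + x u); split.
- by apply: algD => //; apply: (algM Aa); exact: algM.
- move=> u; rewrite big_cons cvalD cvalZ xE; congr (_ + _).
  rewrite atom_class_on_orbit; last exact: orbit_clo (cvalK u).
  rewrite (linZ (alg_lin Aa)) -aE; congr (_ *: _).
  by rewrite (is_adj_sym bb) -bE zy.
- move=> j u ij; rewrite x0 // addr0 (@atom_on_orbit0 (sval i) j) //.
  + exact: lin0 (alg_lin Aa).
  + by move=> /atom_class_eq.
  + exact: orbit_clo (cvalK u).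
Qed.

Lemma restrict_surj (z : forall i, K i -> K i) : dsum_F V z ->
  exists2 x, A x & restrict x = z.
Proof.
move=> [zF [J JP]].
suff [x Ax xE] : exists2 x, A x & forall i (u : K i), x (cval u) = cval (z i u).
  exists x => //; apply: functional_extensionality_dep => i; apply: funext => u.
  by apply: cval_inj; rewrite restrictE.
elim: J z zF JP => [|i J IH] z zF JP.
  by exists (fun=> 0) => [|i u]; [exact: alg0|rewrite JP // cval0].
(* The component at [i] is lifted separately; its lift vanishes on the other spaces, so the two
   lifts can be added. *)
pose z' j : K j -> K j := if pselect (i = j) then fun=> 0 else z j.
have [||x Ax xE] := IH z'.
- move=> j; rewrite /z'; case: pselect => ij; last exact: zF.
  have -> : (fun=> 0 : K j) = restrict (fun=> 0) (i := j).
    by apply: funext => u; apply: cval_inj; rewrite restrictE ?cval0 //; exact: alg0.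
  exact/restrict_finrank/alg0.
- move=> j jJ; rewrite /z'; case: pselect => //= ij; apply: JP => -[] //.
have [y [Ay yE y0]] := restrict_lift1 (zF i).
exists (fun u => x u + y u) => [|j]; first exact: algD.
have [<-|ij] := pselect (i = j) => u.
  by rewrite xE yE /z'; case: pselect => //= _; rewrite add0r.
by rewrite xE y0 // addr0 /z'; case: pselect.
Qed.

Lemma restrict_iso : star_iso (Bops H) A (DSops K) (dsum_F V) restrict.
Proof.
have ext x (F : forall i, K i -> K i) :
    (forall i (u : K i), cval (restrict x u) = cval (F i u)) -> restrict x = F.
  move=> E; apply: functional_extensionality_dep => i; apply: funext => u.
  exact/cval_inj/E.
split; first exact: restrict_dsum.
split=> [x y Ax Ay xy|].
  apply: funext => u; apply/eqP; rewrite -subr_eq0 -scaleN1r; apply/eqP.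
  move: u; apply: (alg_ext0 (algD Ax (algZ (-1) Ay))) => i u cu.
  pose u' : K i := ClosedSub (introT (in_cloP _ _) cu).
  have := congr1 (fun f : forall i, K i -> K i => cval (f i u')) xy.
  by rewrite !restrictE //= => ->; rewrite scaleN1r subrr.
split; first exact: restrict_surj.
split=> [x y Ax Ay|].
  by apply: ext => i u; rewrite restrictE ?cvalD ?restrictE //; exact: algD.
split=> [c x Ax|].
  by apply: ext => i u; rewrite restrictE ?cvalZ ?restrictE //; exact: algZ.
split=> [x y Ax Ay|x y Ax Ay xy i]; last exact: restrict_adj.
by apply: ext => i u; rewrite !restrictE //; exact: algM.
Qed.

End RstarAlgebra.

Theorem theorem5p3 (R : realType) :
  (forall (I : Type) (K : I -> hilbert R) (V : forall i, K i -> Prop),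
     (forall i, dense_subspace (V i)) ->
     purely_atomic (DSops K) (dsum_F V)) /\
  (forall (H : hilbert R) (A : (H -> H) -> Prop),
     Rstar_alg A -> purely_atomic (Bops H) A ->
     exists (I : Type) (K : I -> hilbert R) (V : forall i, K i -> Prop),
       (forall i, dense_subspace (V i)) /\
       exists f : (H -> H) -> (forall i, K i -> K i),
         star_iso (Bops H) A (DSops K) (dsum_F V) f).
Proof.
split=> [I K V|H A RA Aat]; first exact: dsum_purely_atomic.
exists (atom_class A), (class_hilbert RA), (@class_orbit _ _ _ RA); split=> [i|].
  exact: closed_hilbert_dense.
by exists (@restrict _ _ _ RA); exact: restrict_iso.
Qed.
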